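(* There is an absolute constant $\kappa_0>0$ such that for every positive integer $c$ and every positive integer $r$, the competitive ratio of $\mathrm{DLM}_c$ in the dynamic scenario (against all offline algorithms, on inputs whose requests have cardinality at most $r$) is at least $\kappa_0 r^2$. That is, this competitive ratio is $\Omega(r^2)$.
   Context: Online Min-Sum Set Cover (MSSC). Let $\mathcal U$ be a universe of $n$ elements. A permutation is a bijection $\pi:\mathcal U\to\{1,\dots,n\}$, where $\pi(z)$ is the list position of $z$. An input $\mathcal I$ consists of an initial permutation $\pi_0$ and a sequence of nonempty sets $R_1,\dots,R_m\subseteq\mathcal U$, each of cardinality at most $r$. In step $t$, an algorithm holding permutation $\pi_{t-1}$ pays the access cost $\min_{z\in R_t}\pi_{t-1}(z)$. It then picks $\pi_t$ and pays the reordering cost $d(\pi_{t-1},\pi_t)$, the minimum number of adjacent swaps turning $\pi_{t-1}$ into $\pi_t$. An online algorithm is $\rho$-competitive in the dynamic scenario if there is a constant $\xi$ such that for every input $\mathcal I$ and every offline algorithm $\mathrm{Off}$ starting from $\pi_0$, $\mathrm{Alg}(\mathcal I)\le \rho\,\mathrm{Off}(\mathcal I)+\xi$. The competitive ratio is the infimum of such $\rho$. Algorithm $\mathrm{DLM}_c$, where $c$ is a positive integer. Every element $z$ has a budget $b(z)$, initially $0$. The operation fetch$(z)$ moves $z$ to position 1 by $\pi(z)-1$ adjacent swaps, shifting the elements that preceded $z$ back by one, and then sets $b(z)\gets0$. On a request $R$, let $x\in R$ be the element of $R$ with the smallest current position and let $\ell=\pi(x)$. $\mathrm{DLM}_c$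 pays $\ell$, executes fetch$(x)$, and sets $b(y)\gets b(y)+\ell/c$ for every $y\in R\setminus\{x\}$. Then, while some element $z$ has $b(z)\ge\pi(z)$, it fetches such elements to the front. If $k>1$ elements satisfy $b(z)\ge\pi(z)$ simultaneously, $\mathrm{DLM}_c$ fetches them to the first $k$ positions preserving their relative order. *)

(* Defs.v *)
From HB Require Import structures.
From mathcomp Require Import classical_sets reals constructive_ereal ereal.
From mathcomp Require Import all_boot all_order all_algebra all_fingroup.

Set Implicit Arguments.
Unset Strict Implicit.
Unset Printing Implicit Defensive.

Import Order.TTheory GRing.Theory Num.Theory.

Local Open Scope nat_scope.

(* The universe of n elements is 'I_n.  A permutation p : 'S_n sends an element
   to its list position counted from 0, so that the position used in all costs
   and budgets is [pos p z], ranging over 1, ..., n. *)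
Definition pos (n : nat) (p : 'S_n) (z : 'I_n) : nat := (p z).+1.

(* (p * t)%g is t \o p: the elements at the positions i and j are exchanged. *)
Definition adj_swap (n : nat) : rel 'S_n := fun p q =>
  [exists i : 'I_n, exists j : 'I_n,
    (j == i.+1 :> nat) && (q == (p * tperm i j)%g)].

Definition swaps_in (n : nat) (p q : 'S_n) (k : nat) : bool :=
  [exists s : k.-tuple 'S_n, path (@adj_swap n) p s && (last p s == q)].

Lemma connect_adj_swap_tperm (n : nat) (p : 'S_n) (i j : 'I_n) :
  connect (@adj_swap n) p (p * tperm i j)%g.
Proof.
wlog le_ij : i j / i <= j => [hw|].
  by case: (leqP i j) => [|/ltnW] /hw //; rewrite tpermC.
move def_d: (j - i) => d.
elim: d i le_ij def_d p => [|d IHd] i le_ij def_d p.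
  have -> : i = j.
    by apply/val_inj/eqP; rewrite eqn_leq le_ij -subn_eq0 def_d.
  by rewrite tperm1 mulg1.
have lt_ij : i < j by rewrite -subn_gt0 def_d.
pose i' : 'I_n := Ordinal (leq_ltn_trans lt_ij (ltn_ord j)).
have ii' : i != i' by rewrite -val_eqE /= ltn_eqF.
have step q : connect (@adj_swap n) q (q * tperm i i')%g.
  by apply/connect1/existsP; exists i; apply/existsP; exists i'; rewrite !eqxx.
have [ji'|ji'] := eqVneq i' j; first by rewrite -ji'; apply: step.
have -> : tperm i j = (tperm i i' * (tperm i' j * tperm i i'))%g.
  have ji : i != j by rewrite -val_eqE /= ltn_eqF.
  rewrite -[X in (X * _)%g]tpermV -[RHS]/(tperm i' j ^ tperm i i')%g tpermJ.
  by rewrite tpermR tpermD.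
rewrite !mulgA.
apply: connect_trans (connect_trans (step p) _) (step _).
by apply: IHd => //=; rewrite subnS def_d.
Qed.

Lemma swaps_in_ex (n : nat) (p q : 'S_n) : exists k, swaps_in p q k.
Proof.
have /connectP[s ps ->] : connect (@adj_swap n) p q.
  have [ts def_r _] := prod_tpermP (p^-1 * q)%g.
  have -> : q = (p * (p^-1 * q))%g by rewrite mulKVg.
  rewrite def_r; elim: ts {def_r} p => [|t ts IHts] p.
    by rewrite big_nil mulg1.
  rewrite big_cons mulgA.
  exact: connect_trans (connect_adj_swap_tperm _ _ _) (IHts _).
by exists (size s); apply/existsP; exists (in_tuple s); rewrite ps eqxx.
Qed.

Definition reorder_cost (n : nat) (p q : 'S_n) : nat := ex_minn (swaps_in_ex p q).

(* The default value n of the minimum is irrelevant when R is nonempty, since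
   every position is at most n. *)
Definition access_cost (n : nat) (p : 'S_n) (R : {set 'I_n}) : nat :=
  \big[minn/n]_(z in R) pos p z.

(* [ps] lists the permutations held after each of the requests [Rs]. *)
Fixpoint total_cost (n : nat) (p : 'S_n) (Rs : seq {set 'I_n}) (ps : seq 'S_n)
    : nat :=
  match Rs, ps with
  | R :: Rs', q :: ps' =>
      access_cost p R + reorder_cost p q + total_cost q Rs' ps'
  | _, _ => 0
  end.

Definition valid_request (n r : nat) (R : {set 'I_n}) : bool :=
  (R != set0) && (#|R| <= r).

(* An algorithm maps an initial permutation and a request sequence to the list
   of the permutations it holds after each request. *)
Definition algorithm : Type :=
  forall n : nat, 'S_n -> seq {set 'I_n} -> seq 'S_n.

(* The additive constant xi may depend on the universe size n, but on neither
   the input nor the offline solution. *)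
Definition competitive (R : realType) (alg : algorithm) (r : nat) (rho : R)
    : Prop :=
  forall n : nat, exists xi : R,
  forall (p0 : 'S_n) (Rs : seq {set 'I_n}), all (@valid_request n r) Rs ->
  forall off : seq 'S_n, size off = size Rs ->
  ((total_cost p0 Rs (alg n p0 Rs))%:R
     <= rho * (total_cost p0 Rs off)%:R + xi)%R.

Definition competitive_ratio (R : realType) (alg : algorithm) (r : nat)
    : \bar R :=
  ereal_inf [set rho%:E | rho in [set rho : R | competitive alg r rho]]%classic.

(* [ahead p Z y z]: y precedes z once the elements of Z are moved to the first
   #|Z| positions, the order inside Z and outside Z being preserved. *)
Definition ahead (n : nat) (p : 'S_n) (Z : {set 'I_n}) (y z : 'I_n) : bool :=
  if (y \in Z) == (z \in Z) then p y < p z else y \in Z.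

Lemma ahead_irr (n : nat) (p : 'S_n) (Z : {set 'I_n}) (z : 'I_n) :
  ahead p Z z z = false.
Proof. by rewrite /ahead eqxx ltnn. Qed.

Lemma ahead_trans (n : nat) (p : 'S_n) (Z : {set 'I_n}) :
  transitive (ahead p Z).
Proof.
move=> y x z; rewrite /ahead.
by case: (x \in Z); case: (y \in Z); case: (z \in Z) => //=; apply: ltn_trans.
Qed.

Lemma ahead_total (n : nat) (p : 'S_n) (Z : {set 'I_n}) (y z : 'I_n) :
  y != z -> ahead p Z y z || ahead p Z z y.
Proof.
move=> yz; rewrite /ahead; have : p y != p z by rewrite (inj_eq perm_inj).
by rewrite -val_eqE neq_ltn; case: (y \in Z); case: (z \in Z).
Qed.

Lemma front_rank_subproof (n : nat) (p : 'S_n) (Z : {set 'I_n}) (z : 'I_n) :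
  #|[set y | ahead p Z y z]| < n.
Proof.
have card_n : #|[set: 'I_n]| = n by rewrite cardsT card_ord.
rewrite -[X in _ < X]card_n proper_card // properT.
by apply/eqP => /setP/(_ z); rewrite !inE ahead_irr.
Qed.

Definition front_rank (n : nat) (p : 'S_n) (Z : {set 'I_n}) (z : 'I_n) : 'I_n :=
  Ordinal (front_rank_subproof p Z z).

Lemma front_rank_inj (n : nat) (p : 'S_n) (Z : {set 'I_n}) :
  injective (front_rank p Z).
Proof.
have mono y z : ahead p Z y z -> front_rank p Z y < front_rank p Z z.
  move=> yz; apply: proper_card; apply/properP; split.
    by apply/subsetP => x; rewrite !inE => /ahead_trans; apply.
  by exists y; rewrite !inE // ahead_irr.
move=> y z eq_yz; apply/eqP/negPn/negP => /(ahead_total p Z)/orP[] /mono;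
  by rewrite eq_yz ltnn.
Qed.

Definition to_front (n : nat) (p : 'S_n) (Z : {set 'I_n}) : 'S_n :=
  perm (@front_rank_inj n p Z).

Record state (n : nat) :=
  State { order : 'S_n; budget : {ffun 'I_n -> rat} }.

Definition fetch (n : nat) (Z : {set 'I_n}) (s : state n) : state n :=
  State (to_front (order s) Z)
        [ffun z => if z \in Z then 0%R else budget s z].

Definition ready (n : nat) (s : state n) : {set 'I_n} :=
  [set z | ((pos (order s) z)%:R <= budget s z)%R].

(* n rounds exhaust the loop, see [ready_settle]; a round with no ready
   element changes nothing, see [fetch_set0]. *)
Definition settle (n : nat) (s : state n) : state n :=
  iter n (fun s => fetch (ready s) s) s.

Lemma fetch_set0 (n : nat) (s : state n) : fetch set0 s = s.
Proof.
case: s => p b; congr State; last by apply/ffunP => z; rewrite ffunE inE.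
apply/permP => z; rewrite permE; apply/val_inj => /=.
have -> : [set y | ahead p set0 y z] = p @^-1: [set k : 'I_n | k < p z].
  by apply/setP => y; rewrite !inE /ahead !inE.
rewrite card_preimset; last exact: perm_inj.
have le_pz : p z <= n by apply/ltnW/ltn_ord.
by rewrite -sum1dep_card -(big_ord_widen n (fun=> 1) le_pz) sum1_card card_ord.
Qed.

Lemma ready_settle (n : nat) (s : state n) : ready (settle s) = set0.
Proof.
pose A (s : state n) := [set z | (0 < budget s z)%R].
have readyA s' : ready s' \subset A s'.
  by apply/subsetP => z; rewrite !inE; apply: lt_le_trans; rewrite ltr0n.
have AD s' : A (fetch (ready s') s') = A s' :\: ready s'.
  by apply/setP => z; rewrite !inE ffunE inE; case: ifP => _; rewrite ?ltxx.
have decr k : ready (iter k (fun s => fetch (ready s) s) s) = set0 \/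
    #|A (iter k (fun s => fetch (ready s) s) s)| + k <= n.
  elim: k => [|k IHk]; first by right; rewrite addn0 -[n in _ <= n]card_ord max_card.
  rewrite iterS; set t := iter k _ s in IHk *.
  have [e|ne] := eqVneq (ready t) set0; first by rewrite e fetch_set0; left.
  case: IHk => [e|le_n]; first by rewrite e eqxx in ne.
  right; rewrite addnS -addSn; apply: leq_trans le_n; rewrite leq_add2r.
  rewrite AD; apply: proper_card; rewrite properEneq subsetDl andbT.
  apply: contra ne => /eqP/setDidPl; rewrite -setI_eq0 => e.
  by move: e; rewrite setI_eq0 disjoint_sym; move/(disjointWr (readyA t));
     rewrite -setI_eq0 setIid.
case: (decr n) => //; rewrite -[X in _ <= X]add0n leq_add2r leqn0 cards_eq0.
by move=> /eqP e; apply/eqP; rewrite -subset0 -e; apply: readyA.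
Qed.

Definition DLM_step (c n : nat) (s : state n) (R : {set 'I_n}) : state n :=
  if [pick x in R | [forall y in R, pos (order s) x <= pos (order s) y]]
    is Some x
  then
    let l := pos (order s) x in
    let s1 := fetch [set x] s in
    settle (State (order s1)
              [ffun y => if y \in R :\ x
                         then (budget s1 y + l%:R / c%:R)%R
                         else budget s1 y])
  else s.

Definition DLM (c : nat) : algorithm := fun n p0 Rs =>
  [seq order s | s <- scanl (@DLM_step c n) (State p0 [ffun=> 0%R]) Rs].

(* Main.v *)
(* Reordering alone costs DLM a factor of order r^2.  Put g = r - 2.  A set X
   of K elements, K >> cg, always occupies the first K positions of the offline
   list, so that moving some x in X to the offline front costs O(K); in the
   list of DLM, X is spread over positions up to about gK/2.  In each round the
   set B of the last g elements of DLM's list is brought to the front of that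
   list, at a cost of order g * gK.  To this end two oldest elements x of X are
   moved in turn to the offline front, and {a, x} \cup B' is requested until
   DLM fetches x, where B' is the part of B not yet fetched and a is an element
   outside X at a position in (K, 2K]: a is fetched by every such request and
   the budgets of x and of all of B' grow by at least K/c, so O(cg) = O(K)
   requests suffice and, x being far, each b in B has received at least the
   length of the list after two stages.  The offline cost of a round is O(K).
   Fetching B pushes every other element of X back by g, hence the situation
   reproduces itself: an element of X is fetched again only when it has reached
   a position of order gK. *)
From mathcomp Require Import all_boot all_order all_algebra all_fingroup.
From mathcomp Require Import reals constructive_ereal ereal zify lra.
Require Import Defs.

Set Implicit Arguments.
Unset Strict Implicit.
Unset Printing Implicit Defensive.

Import Order.TTheory GRing.Theory Num.Theory.

Local Open Scope nat_scope.

(** * Positions and costs *)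

Section Costs.
Variable n : nat.
Implicit Types (p q o : 'S_n) (z x : 'I_n) (S Z : {set 'I_n}) (Rs : seq {set 'I_n}).

Lemma card_before_pos p m : m <= n -> #|[set y | p y < m]| = m.
Proof.
move=> le_mn.
have -> : [set y | p y < m] = p @^-1: [set k : 'I_n | k < m].
  by apply/setP => y; rewrite !inE.
rewrite card_preimset; last exact: perm_inj.
by rewrite -sum1dep_card -(big_ord_widen n (fun=> 1) le_mn) sum1_card card_ord.
Qed.

Lemma card_before p z : #|[set y | p y < p z]| = p z.
Proof. by rewrite card_before_pos // ltnW. Qed.

(** A position counted from 0 is a number of predecessors, and in [q] those of [z] include its
    predecessors in [p] and, disjointly from them, [S]. The case [S = set0] shows that an element
    does not come forward. *)
Lemma leq_pos_before p q z S :
  (forall y, y \in S -> p z <= p y) ->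
  (forall y, (p y < p z) || (y \in S) -> q y < q z) -> p z + #|S| <= q z.
Proof.
move=> Sz pq; rewrite -[in X in X + _](card_before p) -(card_before q z).
rewrite -cardsUI.
have -> : [set y | p y < p z] :&: S = set0.
  apply/setP => y; rewrite !inE; apply/negP => /andP[lt_y /Sz].
  by rewrite leqNgt lt_y.
rewrite cards0 addn0; apply/subset_leq_card/subsetP => y.
by rewrite !inE => /pq.
Qed.

(** The potential whose decrease bounds the reordering cost from below; [S] will consist of the last
    [g] elements of the online list. *)
Definition rank_sum S p : nat := \sum_(z in S) p z.

Lemma rank_sum_adj_swap p q S :
  adj_swap p q -> rank_sum S p <= rank_sum S q + 1.
Proof.
rewrite /rank_sum => /existsP[i /existsP[j /andP[/eqP ji /eqP ->]]].
(* Only the element at position [j] comes forward, and by one position. *)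
have le1 : \sum_(z in S) (p z == j) <= 1.
  rewrite -big_mkcondr /= sum1_card.
  rewrite -(card1 (p^-1%g j)); apply/subset_leq_card/subsetP => z.
  by rewrite !inE => /andP[_ /eqP <-]; rewrite permK.
apply: (@leq_trans (\sum_(z in S) ((p * tperm i j)%g z + (p z == j)))); last first.
  by rewrite big_split leq_add2l.
apply: leq_sum => z _; rewrite permM.
case: tpermP => [->|->|_ _]; last exact: leq_addr.
  by rewrite ji; apply: leq_trans (leqnSn i) (leq_addr _ _).
by rewrite ji eqxx addn1.
Qed.

Lemma rank_sum_reorder_cost p q S :
  rank_sum S p <= rank_sum S q + reorder_cost p q.
Proof.
rewrite /reorder_cost; case: ex_minnP => k /existsP[[s /= /eqP <-]] + _.
elim: s p => [|p' s IHs] p /=; first by move=> /eqP ->; rewrite addn0.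
move=> /andP[/andP[pp' ps] lst].
have := rank_sum_adj_swap S pp'; have := IHs p'; rewrite ps lst => /(_ isT).
lia.
Qed.

Lemma reorder_cost_id p : reorder_cost p p = 0.
Proof.
rewrite /reorder_cost; case: ex_minnP => k _ /(_ 0).
by rewrite leqn0 => le0; apply/eqP/le0/existsP; exists [tuple]; rewrite /= eqxx.
Qed.

Lemma swaps_in_trans p q o k l :
  swaps_in p q k -> swaps_in q o l -> swaps_in p o (k + l).
Proof.
move=> /existsP[s /andP[ps /eqP sq]] /existsP[t /andP[qt ot]].
by apply/existsP; exists [tuple of s ++ t]; rewrite cat_path last_cat sq ps qt.
Qed.

Lemma swaps_in_adj p (i j : 'I_n) :
  j = i.+1 :> nat -> swaps_in p (p * tperm i j)%g 1.
Proof.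
move=> ji; apply/existsP; exists [tuple (p * tperm i j)%g].
rewrite /= eqxx !andbT; apply/existsP; exists i; apply/existsP; exists j.
by rewrite ji !eqxx.
Qed.

Lemma reorder_cost_tperm p (i j : 'I_n) :
  i <= j -> reorder_cost p (p * tperm i j)%g <= 2 * (j - i).
Proof.
have [-> _|neq_ij le_ij] := eqVneq i j; first by rewrite tperm1 mulg1 reorder_cost_id.
(* [swaps_in] is about an exact number of swaps: 1 for neighbours, and two more for each conjugation
   by an adjacent swap. *)
suff sw : swaps_in p (p * tperm i j)%g (2 * (j - i)).-1.
  rewrite /reorder_cost; case: ex_minnP => k _ /(_ _ sw) /leq_trans; apply.
  exact: leq_pred.
move def_d: (j - i) => d.
elim: d i p le_ij neq_ij def_d => [|d IHd] i p le_ij neq_ij def_d.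
  case/eqP: neq_ij; apply: val_inj => /=; lia.
have lt_ij : i < j by lia.
pose i' : 'I_n := Ordinal (leq_ltn_trans lt_ij (ltn_ord j)).
have ii' : i != i' by rewrite -val_eqE /= ltn_eqF.
have [ji'|ji'] := eqVneq i' j.
  have -> : (2 * d.+1).-1 = 1 by move: (congr1 val ji') => /=; lia.
  by rewrite -ji'; apply: swaps_in_adj.
have -> : tperm i j = (tperm i i' * (tperm i' j * tperm i i'))%g.
  rewrite -[X in (X * _)%g]tpermV -[RHS]/(tperm i' j ^ tperm i i')%g tpermJ.
  by rewrite tpermR tpermD // eq_sym.
have -> : (2 * d.+1).-1 = 1 + ((2 * d).-1 + 1).
  have : d != 0; last lia.
  apply: contraNN ji' => /eqP d0; apply/eqP/val_inj => /=; lia.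
rewrite !mulgA.
apply: swaps_in_trans (swaps_in_adj p (erefl : i' = i.+1 :> nat)) _.
apply: swaps_in_trans _ (swaps_in_adj _ (erefl : i' = i.+1 :> nat)).
apply: IHd => //=; lia.
Qed.

Lemma access_cost_le p (R : {set 'I_n}) z : z \in R -> access_cost p R <= pos p z.
Proof.
rewrite /access_cost; elim: (index_enum _) (mem_index_enum z) => // y s IHs.
rewrite inE big_cons => /orP[/eqP <- -> |/IHs le_s /le_s le_z]; first exact: geq_minl.
by case: ifP; rewrite ?geq_min ?le_z ?orbT.
Qed.

Lemma access_cost_gt0 p (R : {set 'I_n}) : 0 < n -> 0 < access_cost p R.
Proof.
move=> n_gt0; rewrite /access_cost.
by elim/big_ind: _ => // k l k_gt0 l_gt0; rewrite leq_min k_gt0.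
Qed.

Lemma access_cost_leq_n p (R : {set 'I_n}) : access_cost p R <= n.
Proof.
rewrite /access_cost; elim/big_ind: _ => // [k l le_k le_l|z _].
  by rewrite geq_min le_k.
exact: ltn_ord.
Qed.

Lemma total_cost_cat p Rs Rs' (ps ps' : seq 'S_n) : size ps = size Rs ->
  total_cost p (Rs ++ Rs') (ps ++ ps')
    = total_cost p Rs ps + total_cost (last p ps) Rs' ps'.
Proof.
elim: Rs ps p => [|R Rs IHRs] [|q ps] p //= [sz].
by rewrite IHRs // !addnA.
Qed.

Lemma rank_sum_total_cost p Rs (ps : seq 'S_n) S : size ps = size Rs ->
  rank_sum S p <= rank_sum S (last p ps) + total_cost p Rs ps.
Proof.
elim: Rs ps p => [|R Rs IHRs] [|q ps] p //= => [_|[sz]]; first by rewrite addn0.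
have := rank_sum_reorder_cost p q S; have := IHRs ps q sz; lia.
Qed.

Lemma size_leq_total_cost p Rs (ps : seq 'S_n) : 0 < n -> size ps = size Rs ->
  size Rs <= total_cost p Rs ps.
Proof.
move=> n_gt0; elim: Rs ps p => [|R Rs IHRs] [|q ps] p //= [sz].
have := IHRs ps q sz; have := access_cost_gt0 p R n_gt0; lia.
Qed.

Lemma total_cost_const p q Rs x : q x = 0 :> nat ->
    all (fun R : {set 'I_n} => x \in R) Rs ->
  total_cost p Rs (nseq (size Rs) q) <= reorder_cost p q + pos p x + size Rs.
Proof.
move=> qx; case: Rs => //= R Rs /andP[xR xRs].
suff le_sz : total_cost q Rs (nseq (size Rs) q) <= size Rs.
  have := access_cost_le p xR; lia.
elim: Rs xRs => //= R' Rs IHRs /andP[xR' /IHRs].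
have := access_cost_le q xR'; rewrite /pos qx reorder_cost_id; lia.
Qed.

(** Only the first access and the first reordering see the start. So, at the price of an additive
    constant, the offline list may be assumed to start with [X] in front. *)
Lemma total_cost_start p q Rs (ps : seq 'S_n) :
  total_cost p Rs ps
    <= total_cost q Rs ps + (n + \max_(o : 'S_n) reorder_cost p o).
Proof.
case: Rs ps => [|R Rs] [|o ps] //=.
have := access_cost_leq_n p R.
have := @leq_bigmax _ (fun o => reorder_cost p o) o.
set m := \max_(_ : _) _ => /=; lia.
Qed.

(** * Positions after moving a set to the front *)

Lemma before_to_front p Z y z :
  (to_front p Z y < to_front p Z z) = ahead p Z y z.
Proof.
have mono u v : ahead p Z u v -> to_front p Z u < to_front p Z v.
  move=> uv; rewrite !permE; apply: proper_card; apply/properP; split.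
    by apply/subsetP => w; rewrite !inE => /ahead_trans; apply.
  by exists u; rewrite !inE // ahead_irr.
apply/idP/idP => [lt_yz|/mono//].
have [eq_yz|/(ahead_total p Z)/orP[//|/mono]] := eqVneq y z.
  by rewrite eq_yz ltnn in lt_yz.
by rewrite ltnNge ltnW.
Qed.

Lemma before_to_frontN p Z y z : z \notin Z ->
  (to_front p Z y < to_front p Z z) = (p y < p z) || (y \in Z).
Proof.
move=> /negbTE zZ; rewrite before_to_front /ahead zZ.
by case: (y \in Z); rewrite ?orbT ?orbF.
Qed.

Lemma to_front_mem p Z z : z \in Z -> to_front p Z z < #|Z|.
Proof.
move=> zZ; rewrite permE; apply: proper_card; apply/properP; split.
  by apply/subsetP => y; rewrite inE /ahead zZ; case: (y \in Z).
by exists z; rewrite // inE ahead_irr.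
Qed.

Lemma to_front_ge p Z z : z \notin Z -> p z <= to_front p Z z.
Proof.
move=> zZ; rewrite -[X in X <= _]addn0 -(cards0 'I_n).
by apply: leq_pos_before => y; rewrite inE // orbF before_to_frontN // => ->.
Qed.

Lemma to_front_le p Z z : to_front p Z z <= p z + #|Z|.
Proof.
have [/to_front_mem/ltnW/leq_trans->//|zZ] := boolP (z \in Z); first exact: leq_addl.
rewrite -[X in X <= _]card_before -[in X in X + _](card_before p).
apply: leq_trans (leq_card_setU _ _); apply/subset_leq_card/subsetP => y.
by rewrite !inE before_to_frontN.
Qed.

(** Elements before [x] move back by one, at most to the old position of [x]; those behind [x]
    stay. *)
Lemma to_front1_le p x z : to_front p [set x] z <= maxn (p z) (p x).
Proof.
have [->|zx] := eqVneq z x.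
  by have := to_front_mem p (set11 x); rewrite cards1; lia.
have [lt_zx|le_xz] := ltnP (p z) (p x).
  by have := to_front_le p [set x] z; rewrite cards1; lia.
rewrite -[X in X <= _]card_before -[X in _ <= X](card_before p z).
apply/subset_leq_card/subsetP => y.
rewrite !inE before_to_frontN ?inE // => /orP[//|/eqP ->].
by rewrite ltn_neqAle le_xz andbT val_eqE (inj_eq perm_inj) eq_sym.
Qed.

End Costs.

(** * The effect of one request *)

Section Step.
Variables (c n : nat).
Implicit Types (s : state n) (V Z W : {set 'I_n}) (a x y z : 'I_n).

(** Fetched elements have budget 0 and the others only move back, so one pass of the loop already
    reaches a fixed point. *)
Lemma ready_fetch_ready s : ready (fetch (ready s) s) = set0.
Proof.
apply/setP => z; rewrite !inE ffunE /= inE; case: ifP => [_|/negbT zr].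
  by rewrite lern0.
apply/negbTE; apply: contra (zr); apply: le_trans; rewrite ler_nat ltnS.
by apply: to_front_ge; rewrite inE.
Qed.

Lemma settleE s : settle s = fetch (ready s) s.
Proof.
have stable k : iter k (fun s => fetch (ready s) s) (fetch (ready s) s)
    = fetch (ready s) s.
  by elim: k => //= k ->; rewrite ready_fetch_ready fetch_set0.
case: n s stable => [|m] s stable; last by rewrite /settle iterSr stable.
by have -> : ready s = set0; [apply/setP => -[]|rewrite fetch_set0].
Qed.

(** Nothing is ready beforehand and the fetch of [a] brings no other element forward, so only
    elements of [V], whose budgets grow, can become ready; [Z] collects them. *)
Lemma DLM_step_ready s a V (l := ((pos (order s) a)%:R / c%:R)%R : rat) :
    ready s = set0 -> a \notin V -> {in V, forall v, order s a < order s v} ->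
  exists Z : {set 'I_n}, let s' := DLM_step c s (a |: V) in
  [/\ Z \subset V, {in Z, forall z, (pos (order s) z)%:R <= budget s z + l}%R,
      forall z, budget s' z = if z \in a |: Z then 0%R
                else if z \in V then (budget s z + l)%R else budget s z,
      ready s' = set0 &
      [/\ forall z, order s' z <= maxn (order s z) (order s a) + #|Z|,
          {in Z, forall z, order s' z < #|Z|} &
          forall z, z \notin a |: Z -> forall y, (order s' y < order s' z) =
            [|| order s y < order s z, y == a | y \in Z]]].
Proof.
move=> r0 aV ltV.
have -> : DLM_step c s (a |: V) = settle (State (to_front (order s) [set a])
   [ffun y => if y == a then 0%R
              else if y \in V then (budget s y + l)%R else budget s y]).
  rewrite /DLM_step; case: pickP => [x /andP[xR /forall_inP xmin]|/(_ a)]; last first.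
    rewrite setU11 /=; move/negP; case; apply/forall_inP => y.
    by rewrite in_setU1 => /predU1P[->//|/ltV/ltnW]; rewrite /pos ltnS.
  have -> : x = a.
    move: xR; rewrite in_setU1 => /predU1P[//|/ltV lt_ax].
    by have := xmin a (setU11 _ _); rewrite /pos ltnS leqNgt lt_ax.
  congr settle; congr State; apply/ffunP => y; rewrite !ffunE /= !inE.
  by case: (y =P a) => [->|_] //=.
set s1 := State _ _; rewrite settleE; set Z := ready s1.
have ge1 z : z != a -> order s z <= order s1 z.
  by move=> za; apply: to_front_ge; rewrite inE.
have rz z : ~~ ((pos (order s) z)%:R <= budget s z)%R.
  by apply/negP => rz; have := in_set0 z; rewrite -r0 inE rz.
have aZ : a \notin Z by rewrite inE ffunE eqxx lern0.
have Zle z : z \in Z -> z != a /\ ((pos (order s) z)%:R <= budget s1 z)%R.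
  move=> zZ; have za : z != a by apply: contraNneq aZ => <-.
  by split=> //; move: zZ; rewrite inE; apply: le_trans; rewrite ler_nat ltnS ge1.
exists Z; split.
- apply/subsetP => z /Zle[za]; rewrite ffunE (negbTE za); case: ifP => // _.
  by rewrite (negbTE (rz z)).
- move=> z /Zle[za]; rewrite ffunE (negbTE za); case: ifP => // _.
  by rewrite (negbTE (rz z)).
- by move=> z; rewrite !ffunE in_setU1; case: (z == a); case: (z \in Z).
- exact: ready_fetch_ready.
split.
- move=> z; apply: leq_trans (to_front_le _ _ _) _; rewrite leq_add2r.
  exact: to_front1_le.
- by move=> z /=; apply: to_front_mem.
- move=> z; rewrite in_setU1 => /norP[za zZ] y.
  by rewrite /= before_to_frontN // before_to_frontN ?inE // orbA.
Qed.

End Step.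

(** * A stage: requests until a given element is fetched *)

Section Stage.
Variables (c n : nat).
Implicit Types (s : state n) (V X Z W : {set 'I_n}) (a x y z w : 'I_n).

(** Of the [#|X|] elements at the positions from [#|X|] to [2 * #|X| - 1], at most [#|X| - 1] lie in
    [X], because [x] lies further back. *)
Lemma exists_fetchable (p : 'S_n) X W x : x \in X ->
    {in x |: W, forall w, 2 * #|X| <= p w} ->
  exists a, [/\ a \notin X, a \notin x |: W & #|X| <= p a < 2 * #|X|].
Proof.
move=> xX farW; set K := #|X| in farW *.
have K2n : 2 * K <= n.
  by apply: leq_trans (farW x _) _; rewrite ?setU11 // ltnW.
pose D := [set y | p y < 2 * K] :\: [set y | p y < K].
have cardD : K <= #|D|.
  have K1n : K <= n by lia.
  rewrite cardsD.
  have := subset_leq_card (subsetIr [set y | p y < 2 * K] [set y | p y < K]).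
  rewrite !card_before_pos //; by rewrite mul2n -addnn => le_k; rewrite -addnBA ?leq_addr.
have /subsetPn[a aD aX] : ~~ (D \subset X :\ x).
  apply: contraL cardD => /subset_leq_card; rewrite -ltnNge.
  by rewrite /K (cardsD1 x X) xX.
have rng_a : K <= p a < 2 * K by move: aD; rewrite !inE -leqNgt.
exists a; split=> //; last first.
  by apply: contraL rng_a => /farW le_a; rewrite negb_and -leqNgt le_a orbT.
move: aX; rewrite !inE negb_and negbK => /orP[/eqP ax|//].
by move: rng_a; rewrite ax [X in _ && X]ltnNge farW ?setU11 ?andbF.
Qed.

Lemma leq_maxn_fetch u u' v M k l m : u' <= maxn u v + k -> v < M ->
  k + l <= m -> maxn u' M + l <= maxn u M + m.
Proof. lia. Qed.

(* Positions are counted from 0.  W' is the part of W that is never fetched.  The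
   maxima absorb the fetches of a: these only rotate the first 2 * #|X|
   positions. *)
Lemma stage g N s X W x (D P : rat) :
    0 < c -> x \in X -> [disjoint X & W] -> #|W| <= g -> g < 2 * #|X| ->
    {in x |: W, forall w, 2 * #|X| <= order s w} ->
    ready s = set0 -> (forall z, z \notin x |: W -> budget s z = 0%R) ->
    {in W, forall w, budget s x + D <= budget s w}%R ->
    (P <= (pos (order s) x)%:R)%R ->
    (n%:R <= budget s x + N%:R * (#|X|%:R / c%:R))%R ->
  exists Rs W', let s' := foldl (@DLM_step c n) s Rs in
  [/\ size Rs <= N,
      all (fun R : {set 'I_n} => (x \in R) && valid_request g.+2 R) Rs,
      W' \subset W, ready s' = set0 &
  [/\ forall z, z \notin W' -> budget s' z = 0%R,
      {in W', forall w, P + D <= budget s' w}%R,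
      {in (X :\ x) :|: W', forall z y,
         (order s y < order s z) || (y \in W :\: W') -> order s' y < order s' z},
      forall z, maxn (order s' z) (2 * #|X|) + #|W'|
                  <= maxn (order s z) (2 * #|X|) + #|W|.+1 &
      {in x |: W :\: W', forall z,
         order s' z + #|W'| <= 2 * #|X| + #|W|.+1}]].
Proof.
move=> c_gt0 xX dXW + gX; elim: N s W dXW => [|N IHN] s W dXW Wg far r0 b0 bW P_le le_n.
  (* For [N = 0] the budget of [x] is at least [n], so [x] would be ready. *)
  have : x \in ready s.
    rewrite inE; move: le_n; rewrite mul0r addr0; apply: le_trans.
    by rewrite ler_nat ltn_ord.
  by rewrite r0 inE.
have [a [aX aV /andP[Ka aK]]] := exists_fetchable xX far.
have lt_aV : {in x |: W, forall v, order s a < order s v}.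
  by move=> v /far; apply: leq_trans.
have [Z []] := DLM_step_ready c r0 aV lt_aV.
set s1 := DLM_step c s _; set l := (_ / _)%R.
move=> ZV Zl b1 r1 [le1 Z1 ord1].
have gt1 z y : z \notin a |: Z -> (order s y < order s z) || (y \in Z) ->
    order s1 y < order s1 z.
  by move=> zZ; rewrite ord1 // => /orP[]->; rewrite ?orbT.
have mono1 z : z \notin a |: Z -> order s z <= order s1 z.
  move=> zZ; rewrite -[X in X <= _]addn0 -(cards0 'I_n).
  by apply: leq_pos_before => y; rewrite inE // orbF => lt_yz; rewrite gt1 ?lt_yz.
have notZ z : z \in X :\ x :|: W :\: Z -> z \notin a |: Z.
  rewrite !inE => /orP[/andP[zx zX]|/andP[zZ zW]]; apply/norP; split=> //.
  - by apply: contraNneq aX => <-.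
  - apply: contraTN zX => /(subsetP ZV); rewrite in_setU1 (negbTE zx) /=.
    by move=> zW; rewrite (disjointFl dXW).
  - by apply: contraNneq aV => <-; rewrite in_setU1 zW orbT.
have cardV : #|x |: W| = #|W|.+1 by rewrite cardsU1 (disjointFr dXW xX).
have cardZ : #|Z| <= #|W|.+1 by rewrite -cardV subset_leq_card.
(* Besides at most [g] elements of [W] the request contains [a] and [x], hence the bound [g + 2]. *)
have validR : (x \in a |: (x |: W)) && valid_request g.+2 (a |: (x |: W)).
  rewrite !inE eqxx orbT /=; apply/andP; split.
    by apply/set0Pn; exists a; rewrite setU11.
  by rewrite cardsU1 aV cardV /= add1n !ltnS.
have subW1 : W :\: Z \subset W by apply: subsetDl.
(* If this request leads to the fetch of [x], the stage ends and [W'] is what is left of [W]. *)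
have [xZ|xZ] := boolP (x \in Z).
  have cardZW : #|Z| + #|W :\: Z| <= #|W|.+1.
    rewrite -cardV -cardsUI; have -> : Z :&: (W :\: Z) = set0.
      by apply/setP => z; rewrite !inE; case: (z \in Z).
    rewrite cards0 addn0; apply/subset_leq_card/subsetP => z.
    by rewrite inE => /orP[/(subsetP ZV)//|/(subsetP subW1)]; rewrite in_setU1 orbC => ->.
  exists [:: a |: (x |: W)], (W :\: Z) => /=; rewrite validR.
  split=> //; split.
  - move=> z zW; rewrite b1; case: ifPn => // /[!in_setU1]/norP[za zZ].
    have zV : z \notin x |: W.
      rewrite in_setU1; apply/norP; split; first by apply: contraNneq zZ => ->.
      by apply: contraNN zW => zW; rewrite inE zZ.
    by rewrite -in_setU1 (negbTE zV) b0.
  (* When [x] is fetched, [budget s x + l] is at least its position, hence at least [P], and the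
     budget of [w] exceeds that of [x] by at least [D]. *)
  - move=> w wW; have wW0 := subsetP subW1 w wW.
    have /negbTE waZ : w \notin a |: Z by apply: notZ; rewrite in_setU wW orbT.
    rewrite b1 waZ in_setU1 wW0 orbT; have := bW w wW0; have := Zl x xZ; lra.
  - move=> z /notZ zZ y lt_y; apply: gt1 => //; case/orP: lt_y => [->//|].
    by rewrite !inE; case: (y \in Z); rewrite ?orbT // andNb.
  - by move=> z; apply: leq_maxn_fetch (le1 z) aK cardZW.
  - move=> z; rewrite in_setU1 => /predU1P zx.
    have /Z1 : z \in Z.
      by case: zx => [->//|]; rewrite !inE; case: (z \in Z); rewrite // andNb.
    move/ltnW => le_zZ; apply: leq_trans (leq_add le_zZ (leqnn _)) _.
    exact: leq_trans cardZW (leq_addl _ _).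
have ZW : Z \subset W.
  apply/subsetP => z zZ; have := subsetP ZV z zZ; rewrite in_setU1 => /predU1P[zx|//].
  by rewrite -zx zZ in xZ.
have cardZW : #|Z| + #|W :\: Z| = #|W|.
  by rewrite cardsD (setIidPr ZW) subnKC // subset_leq_card.
have xaZ : x \notin a |: Z.
  by rewrite in_setU1; apply/norP; split=> //; apply: contraNneq aX => <-.
have V1Z z : z \in x |: W :\: Z -> (z \notin a |: Z) /\ z \in x |: W.
  rewrite in_setU1 => /predU1P[->|zW]; first by rewrite setU11.
  by rewrite notZ ?in_setU1 ?(subsetP subW1 z zW) ?orbT // in_setU zW orbT.
have bx1 : budget s1 x = (budget s x + l)%R by rewrite b1 (negbTE xaZ) setU11.
have [||||z zV|w wW|||Rs [W' []]] := IHN s1 (W :\: Z).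
- by apply: disjointWr dXW.
- by apply: leq_trans Wg; apply: subset_leq_card.
- by move=> w /V1Z[/mono1 le_w /far]; move/leq_trans; apply.
- exact: r1.
- rewrite b1; case: ifPn => // /[!in_setU1]/norP[za zZ]; rewrite -in_setU1.
  have zV' : z \notin x |: W.
    by apply: contraNN zV; rewrite !inE zZ.
  by rewrite (negbTE zV') b0.
- have [/negbTE waZ wV] : (w \notin a |: Z) /\ w \in x |: W.
    by apply: V1Z; rewrite in_setU1 wW orbT.
  rewrite bx1 b1 waZ wV; have := bW w (subsetP subW1 w wW); lra.
- by apply: le_trans P_le _; rewrite ler_nat ltnS mono1.
(* As [a] lies behind at least [#|X|] elements, the request adds at least [#|X| / c] to the budget
   of [x], which accounts for one unit of [N]. *)
- rewrite bx1; apply: le_trans le_n _; rewrite -natr1 mulrDl mul1r.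
  have : (#|X|%:R / c%:R <= l)%R.
    by rewrite ler_pM2r ?invr_gt0 ?ltr0n // ler_nat leqW.
  lra.
set s' := foldl _ s1 _ => szRs allRs W'W r' [b' bW' lt' le' Z'].
have subW' := subset_trans W'W subW1.
exists (a |: (x |: W) :: Rs), W' => /=; rewrite -/s1 -/s' validR.
split=> //; split=> //.
- move=> z zX y lt_y; have zX1 : z \in X :\ x :|: W :\: Z.
    by move: zX; rewrite !(in_setU _ (X :\ x)) => /orP[->//|/(subsetP W'W)->]; rewrite orbT.
  have zZ := notZ z zX1; apply: lt' => //; case/orP: lt_y => [lt_y|].
    by rewrite gt1 ?lt_y.
  rewrite !inE => /andP[-> yW]; have [yZ|_] := boolP (y \in Z); last by rewrite yW orbT.
  by rewrite gt1 // yZ orbT.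
- move=> z; apply: leq_trans (le' z) _; rewrite !addnS ltnS.
  by apply: leq_maxn_fetch (le1 z) aK _; rewrite cardZW.
- move=> z zW; have [zW1|zW1] := boolP (z \in x |: (W :\: Z) :\: W').
    by apply: leq_trans (Z' z zW1) _; rewrite leq_add2l ltnS subset_leq_card.
  (* An element fetched by this first request sits within the first [2 * #|X|] positions, where the
     maximum in the inductive bound equals [2 * #|X|]. *)
  have /Z1 : z \in Z.
    move: zW zW1; rewrite !inE; case: (z \in Z); rewrite ?orbT ?andbT //=.
    by case: (z == x); case: (z \in W'); case: (z \in W).
  move=> lt_zZ; apply: leq_trans (leq_add (leq_maxl _ (2 * #|X|)) (leqnn _)) _.
  apply: leq_trans (le' z) _; rewrite (maxn_idPr _).
    by rewrite leq_add2l ltnS subset_leq_card.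
  by apply: leq_trans (ltnW lt_zZ) (leq_trans cardZ _); apply: leq_ltn_trans Wg gX.
Qed.

End Stage.

(** * A round of two stages *)

Lemma far_arith g h n i p : n = (g + 6) * h + 3 * g -> 8 <= g ->
    6 * g <= h -> 2 * h <= i + 2 ->
  g * i <= 2 * p + g -> 4 * h <= p /\ n <= 2 * p.+1.
Proof.
move=> def_n g_ge8 g_le_h i_ge.
have : 8 * h <= g * h by rewrite leq_mul2r g_ge8 orbT.
have : g * (2 * h) <= g * (i + 2) by rewrite leq_mul2l i_ge orbT.
by move: def_n; rewrite mulnDr mulnDl; lia.
Qed.

(** The length [n] is large enough for the upper bound of [spread] to keep [X] off the last [g]
    positions. *)
Lemma near_arith g h n i p : n = (g + 6) * h + 3 * g -> i < 2 * h -> 8 <= g ->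
  2 * p <= 8 * h + (g + 2) * (i + 2) -> p < n - g.
Proof.
move=> def_n i_lt g_ge8.
have : (g + 2) * (i + 2) <= (g + 2) * (2 * h + 1) by rewrite leq_mul2l; lia.
move: def_n; rewrite !mulnDl !mulnDr; lia.
Qed.

Section Round.
Variables (c g h n : nat).
Hypotheses (c_gt0 : 0 < c) (g_ge8 : 8 <= g) (g_le_h : 6 * g <= h).
Hypotheses (cg_le_h : c * g <= h) (def_n : n = (g + 6) * h + 3 * g).

(* xs lists X by the time since the last fetch, most recent first; two of its
   elements are fetched in a round, and a round pushes the others back by at
   least g and, beyond position 4h, by at most g + 2. *)
Definition spread (s : state n) (xs : seq 'I_n) : Prop :=
  [/\ size xs = 2 * h, uniq xs, forall z, budget s z = 0%R &
    {in xs, forall z, g * index z xs <= 2 * order s z + g /\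
      2 * order s z <= 8 * h + (g + 2) * (index z xs + 2)}].

Let gh_ge : 8 * h <= g * h. Proof. by rewrite leq_mul2r g_ge8 orbT. Qed.

Let g_le_n : g <= n. Proof. lia. Qed.
Let g_lt_4h : g < 4 * h. Proof. lia. Qed.
Let h4_le : 4 * h <= n - g. Proof. lia. Qed.
Let gain_le : 4 * h + g + 2 + g * h <= n - g. Proof. lia. Qed.

(** By [n <= 2 * g * h] and [c * g <= h], a stage of [h] requests is long enough, each giving at
    least [2 * h / c] to the element to be fetched. *)
Let n_mul_c_le : (n%:R <= h%:R * ((2 * h)%:R / c%:R) :> rat)%R.
Proof.
have le_nc : n * c <= h * (2 * h).
  have le_n : n <= 2 * g * h by lia.
  apply: leq_trans (leq_mul le_n (leqnn c)) _.
  by rewrite (_ : 2 * g * h * c = h * (2 * (c * g))) ?leq_mul2l ?cg_le_h ?orbT //; lia.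
by rewrite mulrA ler_pdivlMr ?ltr0n // -!natrM ler_nat.
Qed.

(** The witness for [S] is the set of the last [g] elements: they come from positions at least
    [n - g] to positions at most [4 * h + g + 2], a gain of at least [g * h] each. *)
Lemma round s xs : spread s xs ->
  exists x1 x2 Rs1 Rs2 xs' S,
  let s' := foldl (@DLM_step c n) (foldl (@DLM_step c n) s Rs1) Rs2 in
  [/\ spread s' xs', xs' =i xs, x1 \in xs /\ x2 \in xs,
      [/\ all (fun R : {set 'I_n} => (x1 \in R) && valid_request g.+2 R) Rs1,
          all (fun R : {set 'I_n} => (x2 \in R) && valid_request g.+2 R) Rs2,
          size Rs1 <= h & size Rs2 <= h] &
      rank_sum S (order s') + g ^ 2 * h <= rank_sum S (order s)].
Proof.
move=> [sz_xs uniq_xs b0 bnd].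
have [ys [x2 [x1 def_xs]]] : exists ys x2 x1, xs = ys ++ [:: x2; x1].
  case/lastP: xs sz_xs {uniq_xs bnd} => [|xs x1]; first by move=> /=; lia.
  case/lastP: xs => [|ys x2]; first by move=> /=; lia.
  by exists ys, x2, x1; rewrite -cats1 -cats1 -catA.
pose X := [set z in xs].
have cardX : #|X| = 2 * h by rewrite cardsE (card_uniqP uniq_xs).
have sz_ys : (size ys).+2 = 2 * h by rewrite -sz_xs def_xs size_cat addn2.
have [x12 x1ys x2ys uniq_ys] : [/\ x2 != x1, x1 \notin ys, x2 \notin ys & uniq ys].
  move: uniq_xs; rewrite def_xs cat_uniq /= !inE.
  by case/and3P=> -> /norP[-> /norP[-> _]] /andP[-> _].
have ix1 : index x1 xs = (size ys).+1.
  by rewrite def_xs index_cat (negbTE x1ys) /= (negbTE x12) eqxx addn1.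
have ix2 : index x2 xs = size ys.
  by rewrite def_xs index_cat (negbTE x2ys) /= eqxx addn0.
have x1xs : x1 \in xs by rewrite def_xs mem_cat !inE eqxx !orbT.
have x2xs : x2 \in xs by rewrite def_xs mem_cat !inE eqxx !orbT.
have x1X : x1 \in X by rewrite inE.
have x2X : x2 \in X by rewrite inE.
(* The two oldest elements, of indices [2 * h - 1] and [2 * h - 2], lie so far back that their
   positions add up to at least [n]. *)
have [[p1_ge p1_le] [p2_ge p2_le]] :
    (4 * h <= order s x1 /\ n <= 2 * (order s x1).+1) /\
    (4 * h <= order s x2 /\ n <= 2 * (order s x2).+1).
  have [lo1 _] := bnd _ x1xs; have [lo2 _] := bnd _ x2xs.
  by split; [apply: far_arith def_n _ _ _ lo1|apply: far_arith def_n _ _ _ lo2];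
    rewrite ?ix1 ?ix2 // -sz_ys ?addSn addn2.
have p12_ge : n <= pos (order s) x1 + pos (order s) x2.
  by rewrite /pos; clear -p1_le p2_le; lia.
have upX z : z \in X -> order s z < n - g.
  rewrite inE => zxs; have [_ up] := bnd _ zxs.
  by apply: near_arith def_n _ g_ge8 up; rewrite -sz_xs index_mem.
pose B := [set z | n - g <= order s z].
have cardB : #|B| = g.
  have := cardsC [set z | order s z < n - g].
  rewrite card_before_pos ?leq_subr // card_ord.
  have -> : ~: [set z | order s z < n - g] = B by apply/setP => z; rewrite !inE -leqNgt.
  by rewrite -[RHS](subnK g_le_n) => /addnI.
have dXB : [disjoint X & B].
  by rewrite disjoint_subset; apply/subsetP => z /upX; rewrite !inE -ltnNge.
have B_ge z : z \in B -> 4 * h <= order s z by rewrite inE; apply: leq_trans.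
have r0 : ready s = set0 by apply/setP => z; rewrite !inE b0 lern0.
have g_lt : g < 2 * #|X| by rewrite cardX mulnA g_lt_4h.
have cardX2 : 2 * #|X| = 4 * h by rewrite cardX mulnA.
have [||||Rs1 [W1 []]] := @stage c n g h s X B x1 0%R (pos (order s) x1)%:R
  c_gt0 x1X dXB (eq_leq cardB) g_lt _ r0 _ _ (lexx _).
- by move=> w; rewrite cardX2 in_setU1 => /predU1P[->//|/B_ge].
- by move=> z _; apply: b0.
- by move=> w _; rewrite !b0 addr0.
- by rewrite b0 add0r cardX n_mul_c_le.
set s1 := foldl _ s Rs1 => sz1 all1 W1B r1 [b1 bW1 lt1 le1 Z1].
have W1_le : #|W1| <= g by rewrite -cardB subset_leq_card.
have dXW1 : [disjoint X & W1] by apply: disjointWr dXB.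
have mono1 z : z \in (X :\ x1) :|: W1 -> order s z <= order s1 z.
  move=> zX; rewrite -[X in X <= _]addn0 -(cards0 'I_n).
  by apply: leq_pos_before => y; rewrite inE // orbF => lt_yz; apply: lt1; rewrite ?lt_yz.
have x2X1 : x2 \in (X :\ x1) :|: W1 by rewrite !inE x12 x2xs.
(* The budgets kept from the first stage enter as [D], so elements of [B] still unfetched would end
   with at least the sum of the positions of [x1] and [x2]. *)
have [|||||Rs2 [W2 []]] := @stage c n g h s1 X W1 x2 (pos (order s) x1)%:R
  (pos (order s) x2)%:R c_gt0 x2X dXW1 W1_le g_lt _ r1.
- move=> w; rewrite cardX2 in_setU1 => /predU1P[->|wW1].
    exact: leq_trans p2_ge (mono1 _ x2X1).
  apply: leq_trans (B_ge _ (subsetP W1B _ wW1)) (mono1 _ _).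
  by rewrite in_setU wW1 orbT.
- by move=> z; rewrite in_setU1 => /norP[_ /b1].
- move=> w /bW1; rewrite addr0; apply: le_trans.
  by rewrite b1 ?add0r // (disjointFr dXW1).
- by rewrite ler_nat ltnS mono1.
- by rewrite b1 ?(disjointFr dXW1) // add0r cardX n_mul_c_le.
set s2 := foldl _ s1 Rs2 => sz2 all2 W2W1 r2 [b2 bW2 lt2 le2 Z2].
(* A budget of at least [n] makes any element ready, so none of [B] is left. *)
have W20 : W2 = set0.
  apply/setP => w; rewrite inE; apply/negP => wW2.
  have : w \in ready s2.
    rewrite inE; apply: le_trans (bW2 w wW2); rewrite -natrD ler_nat.
    by rewrite addnC; apply: leq_trans p12_ge; apply: ltn_ord.
  by rewrite r2 inE.
move: b2 lt2 le2 Z2 {bW2 W2W1}; rewrite {}W20 cards0 !setU0 !setD0 cardX2 => b2 lt2 le2 Z2.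
rewrite cardX2 cardB in le1 Z1.
have up2 z : z \in x2 |: W1 -> order s2 z <= 4 * h + g + 2.
  by move=> /Z2 le_z; clear -le_z W1_le; lia.
have up1 z : z \in x1 |: B :\: W1 -> order s2 z <= 4 * h + g + 2.
  by move=> /Z1 le_z; have le_z2 := le2 z; clear -le_z le_z2 W1_le; lia.
have upB z : z \in B -> order s2 z <= 4 * h + g + 2.
  move=> zB; have [zW|zW] := boolP (z \in W1); first by rewrite up2 // in_setU1 zW orbT.
  by rewrite up1 // in_setU1 in_setD zB zW orbT.
have up_all z : order s2 z <= maxn (order s z) (4 * h) + g + 2.
  by have le_z1 := le1 z; have le_z2 := le2 z; clear -le_z1 le_z2; lia.
(* Although [x2] is fetched last, [x1] may head the new list: both satisfy the bounds of [spread] at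
   the indices 0 and 1. *)
exists x1, x2, Rs1, Rs2, [:: x1, x2 & ys], B; rewrite -/s1 -/s2; split=> //.
- split=> [|||z]; first exact: sz_ys.
  + by rewrite /= inE negb_or eq_sym x12 x1ys x2ys.
  + by move=> z; apply: b2; rewrite inE.
  rewrite in_cons => /predU1P[->|].
    have le_x := up1 x1 (setU11 _ _); rewrite /= eqxx; clear -le_x; lia.
  rewrite in_cons => /predU1P[->|zys].
    have le_x := up2 x2 (setU11 _ _).
    by rewrite /= [x1 == x2]eq_sym (negbTE x12) eqxx; clear -le_x; lia.
  have zx1 : z != x1 by apply: contraNneq x1ys => <-.
  have zx2 : z != x2 by apply: contraNneq x2ys => <-.
  have -> : index z [:: x1, x2 & ys] = (index z ys).+2.
    by rewrite /= [x1 == z]eq_sym (negbTE zx1) [x2 == z]eq_sym (negbTE zx2).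
  have zxs : z \in xs by rewrite def_xs mem_cat zys.
  have zX : z \in X by rewrite inE.
  have ez : index z xs = index z ys by rewrite def_xs index_cat zys.
  have := bnd z zxs; rewrite ez => -[lo up].
  (* All of [B] overtakes [z], which moves back by at least [g], as the lower bound of [spread]
     demands when the index grows by 2. *)
  have : order s z + #|B| <= order s2 z.
    apply: leq_pos_before => y.
      by rewrite inE; apply/leq_trans/ltnW/upX.
    move=> lt_yz; apply: lt2; first by rewrite in_setD1 zx2.
    have [yW|yW] := boolP (y \in W1); first by rewrite orbT.
    by rewrite lt1 // ?in_setU ?in_setD1 ?zx1 ?zX // in_setD yW.
  have le_z := up_all z; rewrite cardB => ge_z; move: lo up.
  by rewrite -addn2 !mulnDr; clear -le_z ge_z; lia.
- move=> z; rewrite def_xs mem_cat !inE.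
  by case: (z == x1); case: (z == x2); case: (z \in ys).
have lo : g * (n - g) <= rank_sum B (order s).
  rewrite -cardB -sum_nat_const; apply: leq_sum => z; rewrite inE.
  by rewrite cardB.
have hi : rank_sum B (order s2) <= g * (4 * h + g + 2).
  by rewrite -cardB -sum_nat_const; apply: leq_sum => z /upB; rewrite cardB.
apply: leq_trans (leq_add hi (leqnn _)) (leq_trans _ lo).
by rewrite -mulnn -mulnA -mulnDr leq_mul2l gain_le orbT.
Qed.

End Round.

(** * Online and offline runs *)

Section Run.
Variables (c n : nat).
Implicit Types (s : state n) (o : 'S_n) (Rs : seq {set 'I_n}) (x z : 'I_n).

Definition run s Rs := [seq order s' | s' <- scanl (@DLM_step c n) s Rs].

Lemma size_run s Rs : size (run s Rs) = size Rs.
Proof. by rewrite size_map size_scanl. Qed.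

Lemma last_run s Rs : last (order s) (run s Rs) = order (foldl (@DLM_step c n) s Rs).
Proof. by elim: Rs s => //= R Rs IHRs s; rewrite -IHRs. Qed.

Lemma run_cat s Rs Rs' :
  run s (Rs ++ Rs') = run s Rs ++ run (foldl (@DLM_step c n) s Rs) Rs'.
Proof. by rewrite /run scanl_cat map_cat. Qed.

(** [x] is exchanged with the front element, which affects only the first [K] positions: the access
    costs at most [K] and the swaps at most [2 * K]. *)
Lemma off_stage o K x Rs : all (fun R : {set 'I_n} => x \in R) Rs -> o x < K ->
  exists off, [/\ size off = size Rs, forall z, o z < K -> last o off z < K &
                  total_cost o Rs off <= 3 * K + size Rs].
Proof.
move=> xRs ltK.
pose i0 : 'I_n := Ordinal (leq_ltn_trans (leq0n _) (ltn_ord (o x))).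
pose o' := (o * tperm i0 (o x))%g.
exists (nseq (size Rs) o'); split; first exact: size_nseq.
  move=> z zK; case: Rs {xRs} => //= _ Rs.
  have -> : last o' (nseq (size Rs) o') = o' by elim: (size Rs).
  by rewrite permM; case: tpermP => //= _; apply: leq_ltn_trans ltK.
have o'x : o' x = 0 :> nat by rewrite permM tpermR.
have := total_cost_const o o'x xRs.
have := reorder_cost_tperm o (leq0n _ : i0 <= o x).
rewrite /pos /= subn0 -/o'; move: (reorder_cost _ _) => k le_k le_t.
apply: leq_trans le_t _; rewrite leq_add2r; clear -le_k ltK; lia.
Qed.

End Run.

(** * Iterated rounds and the initial configuration *)

Section Construction.
Variables (c g h n : nat).
Hypotheses (c_gt0 : 0 < c) (g_ge8 : 8 <= g) (g_le_h : 6 * g <= h).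
Hypotheses (cg_le_h : c * g <= h) (def_n : n = (g + 6) * h + 3 * g).

Lemma rounds N (s : state n) xs (o : 'S_n) : spread g h s xs ->
    {in xs, forall z, o z < 2 * h} ->
  exists Rs off, [/\ all (@valid_request n g.+2) Rs, size off = size Rs,
    N * (g ^ 2 * h) <= total_cost (order s) Rs (run c s Rs) &
    total_cost o Rs off <= N * (14 * h)].
Proof.
elim: N s xs o => [|N IHN] s xs o spr lt_o; first by exists [::], [::].
have := round c_gt0 g_ge8 g_le_h cg_le_h def_n spr.
move=> [x1 [x2 [Rs1 [Rs2 [xs' [S]]]]]].
set s' := foldl _ _ Rs2 => -[spr' eq_xs [x1xs x2xs] [all1 all2 sz1 sz2] gain].
have split_all x Rs : all (fun R : {set 'I_n} => (x \in R) && valid_request g.+2 R) Rs ->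
    all (fun R : {set 'I_n} => x \in R) Rs /\ all (@valid_request n g.+2) Rs.
  by rewrite all_predI => /andP.
have [[xR1 v1] [xR2 v2]] := (split_all _ _ all1, split_all _ _ all2).
have [off1 [szo1 lto1 cost1]] := off_stage xR1 (lt_o _ x1xs).
have [off2 [szo2 lto2 cost2]] := off_stage xR2 (lto1 _ (lt_o _ x2xs)).
have lt_o' : {in xs', forall z, last (last o off1) off2 z < 2 * h}.
  by move=> z; rewrite eq_xs => /lt_o/lto1/lto2.
have [Rs [off [vRs szo costA costO]]] := IHN s' xs' _ spr' lt_o'.
exists ((Rs1 ++ Rs2) ++ Rs), ((off1 ++ off2) ++ off); split.
- by rewrite !all_cat v1 v2.
- by rewrite !size_cat szo1 szo2 szo.
- have lst : last (order s) (run c s (Rs1 ++ Rs2)) = order s'.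
    by rewrite last_run foldl_cat.
  rewrite run_cat total_cost_cat ?size_run // lst foldl_cat -/s' mulSn leq_add //.
  have := rank_sum_total_cost (order s) S (size_run c s (Rs1 ++ Rs2)).
  by rewrite lst => /(leq_trans gain); rewrite leq_add2l.
(* Two stages at [3 * (2 * h)] plus at most [h] requests each make [14 * h]. *)
rewrite !total_cost_cat ?size_cat ?szo1 ?szo2 // last_cat mulSn leq_add //.
clear -cost1 cost2 sz1 sz2; lia.
Qed.

End Construction.

(** In the identity list, [X] is put at the positions [g * i / 2], rounded down, for [i < 2 * h]. *)
Lemma spread_start g h n : 8 <= g -> n = (g + 6) * h + 3 * g -> exists2 xs,
  spread g h (State (1%g : 'S_n) [ffun=> 0%R]) xs & #|[set z in xs]| = 2 * h.
Proof.
move=> g_ge8 def_n.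
have ltF (i : 'I_(2 * h)) : (g * i)./2 < n.
  have := leq_mul (leqnn g) (ltnW (ltn_ord i)); lia.
pose F i := Ordinal (ltF i).
have injF : injective F.
  move=> i j /(congr1 val) /= eqF; apply/val_inj => /=.
  have [lt_ij|lt_ji|//] := ltngtP i j.
    have := leq_mul (leqnn g) lt_ij; lia.
  have := leq_mul (leqnn g) lt_ji; lia.
have uF : uniq (map F (enum 'I_(2 * h))) by rewrite map_inj_uniq ?enum_uniq.
exists (map F (enum 'I_(2 * h))); last first.
  by rewrite cardsE (card_uniqP uF) size_map size_enum_ord.
split=> [||z|z /mapP[i _ ->]].
- by rewrite size_map size_enum_ord.
- exact: uF.
- by rewrite ffunE.
- by rewrite index_map // index_enum_ord /= perm1 /=; clear -g_ge8; lia.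
Qed.


(** * From costs to the competitive ratio *)

Lemma competitive_lower_bound (R : realType) (alg : algorithm) (r n G H C : nat)
    (p0 : 'S_n) (rho : R) :
    0 < G ->
    (forall N, exists Rs off, [/\ all (@valid_request n r) Rs, size off = size Rs,
       N * G <= total_cost p0 Rs (alg n p0 Rs) & total_cost p0 Rs off <= N * H + C]) ->
    competitive alg r rho ->
  (G%:R <= rho * H%:R)%R.
Proof.
move=> G_gt0 inputs /(_ n)[xi comp]; rewrite leNgt; apply/negP => lt_rho.
(* A priori [rho] may be negative; with [m] the bound is monotone in the offline cost. *)
pose m := Num.max rho 0%R.
have m_ge0 : (0 <= m)%R by rewrite le_max lexx orbT.
have d_gt0 : (0 < G%:R - m * H%:R)%R.
  by rewrite subr_gt0 /m; case: (leP rho 0%R) => // _; rewrite mul0r ltr0n.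
(* So many repetitions that the gain [N * (G - m * H)] exceeds the additive terms [m * C + xi]. *)
pose N := (Num.truncn ((m * C%:R + xi) / (G%:R - m * H%:R))).+1.
have [Rs [off [vRs sz costA costO]]] := inputs N.
have := truncnS_gt ((m * C%:R + xi) / (G%:R - m * H%:R))%R.
rewrite -/N ltr_pdivrMr //; apply/negP; rewrite -leNgt.
have := comp p0 Rs vRs off sz.
have : (N%:R * G%:R <= (total_cost p0 Rs (alg n p0 Rs))%:R :> R)%R.
  by rewrite -natrM ler_nat.
have : (rho * (total_cost p0 Rs off)%:R <= m * (N%:R * H%:R + C%:R))%R.
  apply: le_trans (_ : m * (total_cost p0 Rs off)%:R <= _)%R.
    by rewrite ler_wpM2r ?ler0n // le_max lexx.
  by rewrite ler_wpM2l // -natrM -natrD ler_nat.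
by rewrite mulrDr mulrBr [(m * (_ * _))%R]mulrCA; lra.
Qed.

(** On a one-element universe each request costs 1 online and offline. This settles small [r]. *)
Lemma competitive_ge1 (R : realType) (alg : algorithm) (r : nat) (rho : R) :
    0 < r -> (forall n (p : 'S_n) Rs, size (alg n p Rs) = size Rs) ->
    competitive alg r rho ->
  (1 <= rho)%R.
Proof.
move=> r_gt0 sz_alg comp; rewrite -[rho]mulr1.
apply: (@competitive_lower_bound R alg r 1 1 1 1 1%g rho _ _ comp) => // N.
have x0 : (1%g : 'S_1) ord0 = 0 :> nat by rewrite perm1.
have all0 : all (fun R : {set 'I_1} => ord0 \in R) (nseq N setT).
  by rewrite all_nseq inE orbT.
exists (nseq N setT), (nseq N 1%g); split.
- rewrite all_nseq /valid_request cardsT card_ord r_gt0 -card_gt0 cardsT card_ord.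
  by rewrite orbT.
- by rewrite !size_nseq.
- by rewrite muln1 -{1}(size_nseq N [set: 'I_1]) size_leq_total_cost.
have := total_cost_const 1%g x0 all0; rewrite size_nseq reorder_cost_id /pos x0.
by rewrite add0n muln1 addnC.
Qed.

Lemma DLM_competitive_ge (R : realType) (c r g : nat) (rho : R) :
    0 < c -> 8 <= g -> r = g.+2 -> competitive (DLM c) r rho ->
  (g%:R ^+ 2 <= 14%:R * rho)%R.
Proof.
(* This [h] is at least [c * g] and, as [c] is positive, at least [6 * g]. *)
move=> c_gt0 g_ge8 def_r comp; pose h := 6 * (c * g); pose n := (g + 6) * h + 3 * g.
have cg_le_h : c * g <= h by rewrite leq_pmull.
have g_le_h : 6 * g <= h by rewrite leq_pmul2l // leq_pmull.
have h_gt0 : 0 < h by apply: leq_trans g_le_h; rewrite muln_gt0; lia.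
have [xs spr cardX] := spread_start g_ge8 (erefl n).
pose s0 : state n := State 1%g [ffun=> 0%R].
(* The offline list with [X] in front; [C] pays for starting from it. *)
pose o0 := to_front (order s0) [set z in xs].
have lt_o0 : {in xs, forall z, o0 z < 2 * h}.
  by move=> z zxs; rewrite -cardX to_front_mem // inE.
pose C := n + \max_(o : 'S_n) reorder_cost (order s0) o.
have G_gt0 : 0 < g ^ 2 * h by rewrite muln_gt0 h_gt0 expn_gt0 (leq_trans _ g_ge8).
have := @competitive_lower_bound R (DLM c) r n (g ^ 2 * h) (14 * h) C 1%g rho G_gt0 _ comp.
rewrite natrM natrX (natrM _ 14) mulrA [(rho * _)%R]mulrC ler_pM2r ?ltr0n //; apply => N.
have [Rs [off [vRs sz costA costO]]] :=
  @rounds c g h n c_gt0 g_ge8 g_le_h cg_le_h erefl N s0 xs o0 spr lt_o0.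
exists Rs, off; rewrite def_r; split=> //.
by apply: leq_trans (total_cost_start _ o0 _ _) _; rewrite leq_add2r.
Qed.

Theorem theorem14 (R : realType) :
  exists kappa0 : R, (0 < kappa0)%R /\
  forall c r : nat, (0 < c)%N -> (0 < r)%N ->
  ((kappa0 * r%:R ^+ 2)%:E <= competitive_ratio R (DLM c) r)%E.
Proof.
(* The constant is dictated by [r < 10], where the ratio is at least 1 and [r ^ 2 <= 100]. *)
exists (100%:R^-1)%R; split; first by rewrite invr_gt0 ltr0n.
move=> c r c_gt0 r_gt0; apply: le_ereal_inf_tmp => _ [rho /= comp <-].
rewrite lee_fin mulrC ler_pdivrMr ?ltr0n //.
have [r_lt|r_ge] := ltnP r 10.
  have rho1 := competitive_ge1 r_gt0 (fun n p Rs => size_run c _ Rs) comp.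
  have : (r%:R ^+ 2 <= 100%:R :> R)%R.
    by rewrite -natrX ler_nat (leq_sqr r 10) ltnW.
  by move/le_trans; apply; rewrite ler_peMl ?ler0n.
have def_r : r = (r - 2).+2 by lia.
have g_ge8 : 8 <= r - 2 by lia.
have := DLM_competitive_ge c_gt0 g_ge8 def_r comp.
(* For [r >= 10], [r - 2] is at least [4 * r / 5], and [16 / 25 / 14] exceeds [1 / 100]. *)
have : (4%:R * r%:R <= 5%:R * (r - 2)%:R :> R)%R by rewrite -!natrM ler_nat; lia.
have : (0 <= r%:R :> R)%R by rewrite ler0n.
nra.
Qed.
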